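(* Let $S$ be a positive semifield and $(X,a,b)$ a $\delta$-algebra. Then for all $A,B\subseteq X$ and all $\lambda\in S\setminus\{0\}$: \[ \lambda\cdot^a\bigsqcup^b_{x\in A}x=\bigsqcup^b_{x\in A}\lambda\cdot^a x,\qquad \bigsqcup^b_{x\in A}x+^a\bigsqcup^b_{y\in B}y=\bigsqcup^b_{(x,y)\in A\times B}x+^a y. \]
   Context: $S$ positive: $a+b=0\Rightarrow a=b=0$; semifield: nonzero elements invertible. $\mathcal S$: monad on Set with $\mathcal SX$ the finitely supported $X\to S$, $\mathcal S(f)(\phi)(y)=\sum_{x\in f^{-1}\{y\}}\phi(x)$, unit Dirac functions, $\mu(\Psi)(x)=\sum_\phi\Psi(\phi)\phi(x)$. $\mathcal P$: powerset monad. For $\Phi\in\mathcal S\mathcal PX$, with $\ni_X=\{(A,x)\mid x\in A\}$: $\delta_X(\Phi)=\{\phi\in\mathcal SX\mid\exists\psi\in\mathcal S(\ni_X).\ \forall A.\ \Phi(A)=\sum_{x\in A}\psi(A,x),\ \forall x.\ \phi(x)=\sum_{A\ni x}\psi(A,x)\}$. A $\delta$-algebra is a set $X$ with an $\mathcal S$-algebra structure $a\colon\mathcal SX\to X$ and a $\mathcal P$-algebra structure $b\colon\mathcal PX\to X$ such that $a\circ\mathcal S(b)=b\circ\mathcal P(a)\circ\delta_X$. Notation: $\bigsqcup^b_{i\in I}x_i=b(\{x_i\mid i\in I\})$; $x+^ay=a(x\mapsto1,y\mapsto1)$ (the function with value $1$ at $x$ and $y$, or $2$ at $x$ if $x=y$);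 $\lambda\cdot^ax=a(x\mapsto\lambda)$. *)

(* Defs.v *)
From mathcomp Require Import all_boot all_algebra.
From mathcomp Require Import all_classical.

Set Implicit Arguments.
Unset Strict Implicit.
Unset Printing Implicit Defensive.

Import GRing.Theory.
Local Open Scope classical_set_scope.
Local Open Scope ring_scope.

(* Semirings are not assumed commutative, and 0 = 1 is not excluded. *)
Definition positive_semiring (S : pzSemiRingType) : Prop :=
  forall x y : S, x + y = 0 -> x = 0 /\ y = 0.

Definition semifield (S : pzSemiRingType) : Prop :=
  forall x : S, x != 0 -> exists y : S, x * y = 1 /\ y * x = 1.

Section FiniteSupport.
Variable S : pzSemiRingType.

Definition supp (X : Type) (f : X -> S) : set X := [set x | f x != 0].

(* [{classic X}] is [X] with its classical choice structure, which [\sum_(_ \in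
   _)] requires. That operator is the sum over [D `&` supp f] if this set is
   finite and 0 otherwise; below it is only used with finite [supp f]. *)
Definition fsum (X : Type) (D : set X) (f : X -> S) : S :=
  \sum_(x \in (D : set {classic X})) f x.

Lemma fsum_neq0 (X : Type) (D : set X) (f : X -> S) :
  fsum D f != 0 -> exists2 x, D x & f x != 0.
Proof.
move=> s0; apply: contrapT => H; move/eqP: s0; apply.
rewrite /fsum; apply: fsbig1 => x Dx; apply/eqP/negPn/negP => fx0.
by apply: H; exists x.
Qed.

Record fsupp (X : Type) : Type := Fsupp {
  fsval :> X -> S;
  fsval_finite : finite_set (supp fsval) }.

Lemma fsingle_finite (X : Type) (x : X) (l : S) :
  finite_set (supp (fun z => if `[< z = x >] then l else 0)).
Proof.
apply: sub_finite_set (finite_set1 x) => z; rewrite /supp /=.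
by case: asboolP => // _; rewrite eqxx.
Qed.

(* x |-> l *)
Definition fsingle (X : Type) (x : X) (l : S) : fsupp X :=
  Fsupp (fsingle_finite x l).

Lemma fpair_finite (X : Type) (x y : X) :
  finite_set (supp (fun z => fsingle x 1 z + fsingle y 1 z)).
Proof.
have : finite_set (supp (fsingle x 1) `|` supp (fsingle y 1)).
  by rewrite finite_setU; split; apply: fsval_finite.
apply: sub_finite_set => z; rewrite /supp /mkset => h.
case: (eqVneq (fsingle x 1 z) 0) => [e|]; last by left.
by right; apply: contra h => /eqP e'; rewrite e e' addr0.
Qed.

(* x |-> 1, y |-> 1; the value at x is 1 + 1 when x = y *)
Definition fpair (X : Type) (x y : X) : fsupp X := Fsupp (fpair_finite x y).

Lemma fsmap_finite (X Y : Type) (f : X -> Y) (phi : fsupp X) :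
  finite_set (supp (fun y => fsum (f @^-1` [set y]) phi)).
Proof.
apply: sub_finite_set (finite_image f (fsval_finite phi)) => y.
by move=> /fsum_neq0 [x <- px]; exists x.
Qed.

Definition fsmap (X Y : Type) (f : X -> Y) (phi : fsupp X) : fsupp Y :=
  Fsupp (fsmap_finite f phi).

Definition fsunit (X : Type) (x : X) : fsupp X := fsingle x 1.

Lemma fsmult_finite (X : Type) (Psi : fsupp (fsupp X)) :
  finite_set (supp (fun x => fsum setT (fun phi => Psi phi * phi x))).
Proof.
have : finite_set (\bigcup_(phi in supp Psi) supp (fsval phi)).
  by apply: bigcup_finite; [exact: fsval_finite | move=> *; exact: fsval_finite].
apply: sub_finite_set => x /fsum_neq0 [phi _ h]; exists phi.
  by apply: contra h => /eqP ->; rewrite mul0r.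
by apply: contra h => /eqP ->; rewrite mulr0.
Qed.

Definition fsmult (X : Type) (Psi : fsupp (fsupp X)) : fsupp X :=
  Fsupp (fsmult_finite Psi).

Definition ni (X : Type) : Type := {p : set X * X | p.1 p.2}.

Definition delta (X : Type) (Phi : fsupp (set X)) : set (fsupp X) :=
  [set phi : fsupp X | exists psi : fsupp (ni X),
     (forall A : set X, Phi A = fsum [set p | (sval p).1 = A] psi) /\
     (forall x : X, phi x = fsum [set p | (sval p).2 = x] psi)].

Record S_algebra (X : Type) (a : fsupp X -> X) : Prop := {
  S_alg_unit : forall x : X, a (fsunit x) = x;
  S_alg_mult : forall Psi : fsupp (fsupp X),
    a (fsmult Psi) = a (fsmap a Psi) }.

Record P_algebra (X : Type) (b : set X -> X) : Prop := {
  P_alg_unit : forall x : X, b [set x] = x;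
  P_alg_mult : forall F : set (set X),
    b (\bigcup_(A in F) A) = b (b @` F) }.

Record delta_algebra (X : Type) (a : fsupp X -> X) (b : set X -> X) : Prop := {
  delta_alg_S : S_algebra a;
  delta_alg_P : P_algebra b;
  delta_alg_law : forall Phi : fsupp (set X),
    a (fsmap b Phi) = b (a @` delta Phi) }.

Definition alg_add (X : Type) (a : fsupp X -> X) (x y : X) : X :=
  a (fpair x y).

Definition alg_scale (X : Type) (a : fsupp X -> X) (l : S) (x : X) : X :=
  a (fsingle x l).

End FiniteSupport.

Definition bigsqcup (X : Type) (b : set X -> X) (I : Type) (D : set I)
  (f : I -> X) : X := b [set f i | i in D].

(* Main.v *)
(** For [u <= v] iff [b {u, v} = v], [b] computes suprema. If [psi] is a coupling
    with marginals [Phi] and [phi], then [a phi <= a (S(b) Phi)]; couplings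
    concentrated on one or two pairs give the inequality [>=] in both equations.
    Scaling by a unit [l] is then monotone with monotone inverse, so it preserves
    suprema. For the sum it suffices, by commutativity, to treat
    [x + b B]. If [B = {x}] this is trivial. Otherwise positivity forces a
    coupling for [{x} |-> 1, B |-> 1] to live on these two sets, so its second
    marginal is [x + \sum_j q_j y_j] with [y_j \in B] and [\sum_j q_j = 1], that is,
    [\sum_j q_j (x + y_j)], a convex combination of elements of
    [C = {x + y | y \in B}]. The law at [C |-> 1] bounds it by [1 * b C = b C]. *)

Require Import Defs.
From mathcomp Require Import all_boot all_algebra.
From mathcomp Require Import all_classical.

Set Implicit Arguments.
Unset Strict Implicit.
Unset Printing Implicit Defensive.

Import GRing.Theory.
Local Open Scope classical_set_scope.
Local Open Scope ring_scope.

(** * Sums of finitely supported functions *)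

Section FiniteSums.
Variable S : pzSemiRingType.
Implicit Types X Y : Type.

Lemma fsupp_ext X (phi psi : fsupp S X) : phi =1 psi -> phi = psi.
Proof.
case: phi psi => f Hf [g Hg] /= /funext fg; rewrite fg in Hf *.
by congr Fsupp; exact: Prop_irrelevance.
Qed.

Lemma eq_fsum X (D : set X) (f g : X -> S) :
  (forall x, D x -> f x = g x) -> fsum D f = fsum D g.
Proof. by move=> fg; apply: eq_fsbigr => x /set_mem; exact: fg. Qed.

Lemma eq_fsuml X (D E : set X) (f : X -> S) :
  (forall x, D x <-> E x) -> fsum D f = fsum E f.
Proof. by move=> DE; congr fsum; apply/seteqP; split=> x /DE. Qed.

(** Any duplicate-free list covering the support computes the sum, with [D] as a filter. Sums with
    different supports can thus share one list, and the lemmas on list-indexed sums apply. *)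
Lemma fsum_seq X (r : seq {classic X}) (D : set X) (f : X -> S) : uniq r ->
  (forall x, f x != 0 -> (x : {classic X}) \in r) ->
  fsum D f = \sum_(x <- r | `[< D x >]) f x.
Proof.
move=> ur fr; rewrite (bigfs _ ur) //=; last first.
  by move=> x _; apply: contraNeq => /fr.
rewrite /fsum; apply: eq_fsbigl; apply/seteqP; split=> x /=.
- by move=> ?; apply/asboolP.
- by move/asboolP.
Qed.

Lemma finite_supp_seq X (f : X -> S) : finite_set (supp f) ->
  exists2 r : seq {classic X}, uniq r & forall x, f x != 0 <-> (x : {classic X}) \in r.
Proof.
move=> /(@finite_seqP {classic X})[r fr]; exists (undup r); first exact: undup_uniq.
move=> x; rewrite mem_undup.
by split=> h; [have : supp f x by []; rewrite fr | have : [set` r] x by []; rewrite -fr].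
Qed.

Lemma fsum0 X (D : set X) (f : X -> S) : (forall x, D x -> f x = 0) -> fsum D f = 0.
Proof. by move=> f0; apply: fsbig1. Qed.

Lemma fsum1 X (D : set X) (f : X -> S) x : D x ->
  (forall y, D y -> y <> x -> f y = 0) -> fsum D f = f x.
Proof.
move=> Dx f0; rewrite /fsum -(fsbig_set1 +%R (x : {classic X}) f).
apply/esym/fsbig_widen => [y -> //|y [Dy /= yx]]; exact: f0.
Qed.

Lemma fsumD X (D : set X) (f g : X -> S) :
  finite_set (supp f) -> finite_set (supp g) ->
  fsum D (fun x => f x + g x) = fsum D f + fsum D g.
Proof.
move=> fin gin.
have [r ur fr] : exists2 r : seq {classic X}, uniq r &
    forall x, f x != 0 \/ g x != 0 -> (x : {classic X}) \in r.
  have [r _ fr] := finite_supp_seq fin; have [s _ gs] := finite_supp_seq gin.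
  exists (undup (r ++ s)) => [|x]; first exact: undup_uniq.
  move=> h; suff : (x : {classic X}) \in r ++ s by rewrite -mem_undup.
  by rewrite mem_cat; case: h => [/fr|/gs] xrs; apply/orP; [left | right].
rewrite !(@fsum_seq _ r) ?big_split //.
- by move=> x; move=> ?; apply: fr; right.
- by move=> x; move=> ?; apply: fr; left.
- move=> x h; apply: fr; have [fx0|] := eqVneq (f x) 0; last by left.
  by right; move: h; rewrite fx0 add0r.
Qed.

Lemma fsumID X (D E : set X) (f : X -> S) : finite_set (supp f) ->
  fsum D f = fsum (D `&` E) f + fsum (D `&` ~` E) f.
Proof.
move=> /finite_supp_seq [r ur fr].
have fr' x : f x != 0 -> (x : {classic X}) \in r by move/fr.
rewrite !(fsum_seq _ ur fr') (bigID (fun x => `[< E x >])) /=.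
congr (_ + _); apply: eq_bigl => x; first by rewrite asbool_and.
by rewrite -asbool_neg -asbool_and.
Qed.

(** Splitting off the point [x] writes the zero sum as [f x] plus a remainder, and positivity kills
    both summands. *)
Lemma fsum_pos X (D : set X) (f : X -> S) x :
  positive_semiring S -> finite_set (supp f) ->
  fsum D f = 0 -> D x -> f x = 0.
Proof.
move=> pos fin; rewrite (fsumID D [set x] fin) => /pos[+ _] Dx.
by rewrite (@fsum1 _ _ _ x) // => y [_ /= ->].
Qed.

(** Change of variables: expanding [fsmap] gives a double sum over the support list [r] of [phi] and
    its image [s]. After exchanging the sums, each [x] contributes only at [y = f x]. *)
Lemma fsum_fsmap X Y (f : X -> Y) (phi : fsupp S X) (D : set Y) (g : Y -> S) :
  fsum D (fun y => fsmap f phi y * g y) =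
  fsum (f @^-1` D) (fun x => phi x * g (f x)).
Proof.
have [r ur pr] := finite_supp_seq (fsval_finite phi).
have pr' x : phi x != 0 -> (x : {classic X}) \in r by move/pr.
pose s : seq {classic Y} := undup (map (f : {classic X} -> {classic Y}) r).
have us : uniq s by rewrite undup_uniq.
rewrite (fsum_seq _ us) => [|y yN0]; last first.
  rewrite mem_undup.
  have /fsum_neq0[x <- /pr xr] : fsum (f @^-1` [set y]) phi != 0.
    by apply: contra yN0 => /eqP /= ->; rewrite mul0r.
  exact: (@map_f {classic X} {classic Y}).
rewrite (fsum_seq _ ur) => [|x xN0]; last first.
  by apply/pr; apply: contra xN0 => /eqP ->; rewrite mul0r.
under eq_bigr => y _ do rewrite /= (fsum_seq _ ur pr') mulr_suml big_mkcond /=.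
rewrite exchange_big [RHS]big_mkcond /= big_seq [RHS]big_seq.
apply: eq_bigr => x xr.
have fxs : (f x : {classic Y}) \in s.
  by rewrite mem_undup; exact: (@map_f {classic X} {classic Y}).
rewrite big_mkcond (bigD1_seq _ fxs us) /= big1 => [|y yx]; last first.
  case: asboolP => // _; case: asboolP => // e.
  by move: yx; rewrite -e eqxx.
by rewrite addr0; do 2 case: asboolP => //.
Qed.

Lemma fsum_fsmap1 X Y (f : X -> Y) (phi : fsupp S X) (D : set Y) :
  fsum D (fsmap f phi) = fsum (f @^-1` D) phi.
Proof.
rewrite -(@eq_fsum _ D (fun y => fsmap f phi y * 1)) => [|y _]; last exact: mulr1.
rewrite (fsum_fsmap f phi D (fun=> 1)).
by apply: eq_fsum => x _; exact: mulr1.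
Qed.

(** * Dirac functions, pairs and the functor on them *)

Lemma fsum_fsingle X (x : X) (l : S) (D : set X) :
  fsum D (fsingle x l) = if `[< D x >] then l else 0.
Proof.
case: asboolP => Dx.
  by rewrite (fsum1 Dx) => [|y _ yx] /=; case: asboolP.
by apply: fsum0 => y Dy /=; case: asboolP => // yx; case: Dx; rewrite -yx.
Qed.

Lemma fsum_fpair X (x y : X) (D : set X) :
  fsum D (fpair S x y) = fsum D (fsingle x 1) + fsum D (fsingle y 1).
Proof. by rewrite fsumD //; exact: fsval_finite. Qed.

Lemma fsmap_fsingle X Y (f : X -> Y) x (l : S) :
  fsmap f (fsingle x l) = fsingle (f x) l.
Proof.
apply: fsupp_ext => y /=; rewrite fsum_fsingle /=.
case: asboolP => [->|fxy]; first by case: asboolP.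
by case: asboolP => // /esym.
Qed.

Lemma fsmap_fpair X Y (f : X -> Y) x y :
  fsmap f (fpair S x y) = fpair S (f x) (f y).
Proof.
apply: fsupp_ext => z.
transitivity (fsingle (f x) 1 z + fsingle (f y) 1 z : S) => //.
by rewrite -!fsmap_fsingle -fsum_fpair.
Qed.

Lemma fpairC X (x y : X) : fpair S x y = fpair S y x.
Proof. by apply: fsupp_ext => z /=; rewrite addrC. Qed.

Lemma fsmult_fsingle X (x : X) (l m : S) :
  fsmult (fsingle (fsingle x m) l) = fsingle x (l * m).
Proof.
apply: fsupp_ext => z /=.
rewrite (@fsum1 _ _ _ (fsingle x m)) //= => [|phi _ h].
  by case: asboolP => // _; case: asboolP => // _; rewrite mulr0.
by case: asboolP => // _; rewrite mul0r.
Qed.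

Lemma fsmap_comp X Y (Z : Type) (f : X -> Y) (g : Y -> Z) (phi : fsupp S X) :
  fsmap g (fsmap f phi) = fsmap (g \o f) phi.
Proof. by apply: fsupp_ext => z /=; rewrite fsum_fsmap1. Qed.

Lemma frestr_finite X (D : set X) (phi : fsupp S X) :
  finite_set (supp (fun x => if `[< D x >] then phi x else 0)).
Proof.
apply: sub_finite_set (fsval_finite phi) => x; rewrite /supp /=.
by case: asboolP => // _; rewrite eqxx.
Qed.

Definition frestr X (D : set X) (phi : fsupp S X) : fsupp S X :=
  Fsupp (frestr_finite D phi).

Lemma fsum_frestr X (D E : set X) (phi : fsupp S X) :
  fsum E (frestr D phi) = fsum (E `&` D) phi.
Proof.
rewrite (fsumID _ D (fsval_finite _)) [X in _ + X]fsum0 => [|x [_ /= nDx]].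
  by rewrite addr0; apply: eq_fsum => x [_ Dx] /=; case: asboolP.
by case: asboolP.
Qed.

Lemma eq_fsmap X Y (f g : X -> Y) (phi : fsupp S X) :
  (forall x, phi x != 0 -> f x = g x) -> fsmap f phi = fsmap g phi.
Proof.
move=> fg; apply: fsupp_ext => y.
have [r ur pr] := finite_supp_seq (fsval_finite phi).
have pr' x : phi x != 0 -> (x : {classic X}) \in r by move/pr.
rewrite /= !(fsum_seq _ ur pr') big_seq_cond [RHS]big_seq_cond.
apply: eq_bigl => x; case xr: ((x : {classic X}) \in r) => //=.
by rewrite fg //; apply/pr.
Qed.

Lemma fsmap_cst X Y (y : Y) (phi : fsupp S X) :
  fsmap (fun=> y) phi = fsingle y (fsum setT phi).
Proof.
apply: fsupp_ext => z /=; case: asboolP => [->|zy].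
  by apply: eq_fsuml => x; split.
by apply: fsum0 => x /= /esym.
Qed.

(** * Couplings and their marginals *)

Definition ni_set X (p : ni X) : set X := (sval p).1.
Definition ni_elt X (p : ni X) : X := (sval p).2.

(** Both marginals become pushforwards of [psi] along the projections, so functoriality can be used
    on couplings. *)
Lemma deltaP X (Phi : fsupp S (set X)) (phi : fsupp S X) :
  delta Phi phi <->
  exists2 psi : fsupp S (ni X),
    Phi = fsmap (@ni_set X) psi & phi = fsmap (@ni_elt X) psi.
Proof.
split=> [[psi [h1 h2]]|[psi -> ->]]; last by exists psi.
by exists psi; apply: fsupp_ext.
Qed.

Lemma delta_fsingle X (A : set X) x (l : S) :
  A x -> delta (fsingle A l) (fsingle x l).
Proof.
move=> Ax; apply/deltaP; exists (fsingle (exist (fun p => p.1 p.2) (A, x) Ax) l).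
  by rewrite fsmap_fsingle.
by rewrite fsmap_fsingle.
Qed.

Lemma delta_fpair X (A B : set X) x y :
  A x -> B y -> delta (fpair S A B) (fpair S x y).
Proof.
move=> Ax By; apply/deltaP; exists (fpair S
    (exist (fun p => p.1 p.2) (A, x) Ax) (exist (fun p => p.1 p.2) (B, y) By)).
  by rewrite fsmap_fpair.
by rewrite fsmap_fpair.
Qed.

(* [theta] is the part of the coupling lying over [B]; its second components are the
   [y_j] and its values the weights [q_j]. *)
Lemma delta_fpair_set1 X (x : X) (B : set X) (phi : fsupp S X) :
  positive_semiring S -> [set x] <> B -> delta (fpair S [set x] B) phi ->
  exists2 theta : fsupp S (ni X),
    (forall p, theta p != 0 -> ni_set p = B) /\ fsum setT theta = 1 &
    phi = fsmult (fsmap (fun p => fpair S x (ni_elt p)) theta).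
Proof.
move=> pos xB /deltaP[psi Phi_psi ->].
have Phi_sum A : fsum [set p | ni_set p = A] psi = fpair S [set x] B A.
  by rewrite Phi_psi.
(* The fibre of [psi] over a set other than [[set x]] and [B] has total mass 0, so positivity makes
   each of its entries 0. *)
have psi0 p : ni_set p <> [set x] -> ni_set p <> B -> psi p = 0.
  move=> px pB; have := Phi_sum (ni_set p) => /=.
  case: asboolP => // _; case: asboolP => // _; rewrite addr0.
  by move=> h; apply: (fsum_pos pos (fsval_finite psi) h).
have sum_x : fsum [set p | ni_set p = [set x]] psi = 1.
  rewrite Phi_sum /=; case: asboolP => // _.
  by case: asboolP => // _; rewrite addr0.
have sum_B : fsum [set p | ni_set p = B] psi = 1.
  rewrite Phi_sum /=; case: asboolP => [/esym //|_].
  by case: asboolP => // _; rewrite add0r.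
pose theta := frestr [set p : ni X | ni_set p = B] psi.
have sum_theta : fsum setT theta = 1.
  by rewrite fsum_frestr setTI.
exists theta.
  by split=> // p /=; case: asboolP => //; rewrite eqxx.
apply: fsupp_ext => z.
(* The value of [fsmult] at [z] is a sum over functions; the change of variables pulls it back to a
   sum over [p], where each [fpair] splits into two Dirac terms. *)
transitivity (fsum setT
    (fun p => theta p * fsingle x 1 z + theta p * fsingle (ni_elt p) 1 z)); last first.
  transitivity (fsum setT (fun p => theta p * fpair S x (ni_elt p) z)).
    by apply: eq_fsum => p _; rewrite -mulrDr.
  by rewrite -(fsum_fsmap (fun p => fpair S x (ni_elt p)) theta setT
                 (fun phi : fsupp S X => phi z)).
rewrite fsumD; first last.
- apply: sub_finite_set (fsval_finite theta) => p.
  by rewrite /supp /=; apply: contra => /eqP ->; rewrite mul0r.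
- apply: sub_finite_set (fsval_finite theta) => p.
  by rewrite /supp /=; apply: contra => /eqP ->; rewrite mul0r.
(* The part of [psi] off [B] lies over [[set x]] and matches the Dirac terms at [x]; the part over
   [B] matches those at [ni_elt p]. *)
rewrite /= (fsumID _ [set p : ni X | ni_set p = B] (fsval_finite psi)) addrC.
congr (_ + _).
  case: asboolP => [->|zx].
    rewrite [RHS](_ : _ = fsum setT theta); last first.
      by apply: eq_fsum => p _; rewrite /=; case: asboolP => // _; rewrite mulr1.
    (* At [z = x] both sides are 1: the mass of [theta] on the right, the mass of [psi] over
       [[set x]] on the left. *)
    rewrite sum_theta -sum_x.
    rewrite [LHS](fsumID _ [set p : ni X | ni_set p = [set x]]); last first.
      exact: fsval_finite.
    rewrite [X in _ + X = _]fsum0 ?addr0 => [|p [[/= _ pB] px]]; last exact: psi0.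
    apply: eq_fsuml => -[[A y] /= Ay]; rewrite /ni_set /ni_elt /=.
    split=> [[_ ->] //|Ax]; split=> //; split; last by rewrite Ax.
    by rewrite Ax in Ay.
  rewrite [RHS]fsum0 => [|p _]; last by rewrite mulr0.
  apply: fsum0 => -[[A y] /= Ay] [/= yz AB]; apply: psi0 => // Ax.
  have xy : [set x] y by rewrite -Ax.
  by apply: zx; rewrite -yz.
rewrite -fsum_frestr -/theta.
rewrite [RHS](fsumID _ [set p : ni X | ni_elt p = z]); last first.
  apply: sub_finite_set (fsval_finite theta) => p.
  by rewrite /supp /=; apply: contra => /eqP ->; rewrite mul0r.
rewrite [X in _ = _ + X]fsum0 ?addr0 => [|p [_ /= pz]]; last first.
  by case: (asboolP (z = _)) => [/esym //|_]; rewrite mulr0.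
rewrite setTI; apply: eq_fsum => p /= ->.
by case: (asboolP (z = z)) => // _; rewrite mulr1.
Qed.

End FiniteSums.

(** * The order induced by [b] *)

Section DeltaAlgebra.
Variables (S : pzSemiRingType) (X : Type) (a : fsupp S X -> X) (b : set X -> X).
Hypothesis Xab : delta_algebra a b.

Let Sa := delta_alg_S Xab.
Let Pb := delta_alg_P Xab.

Definition Ple (u v : X) : Prop := b [set u; v] = v.

Lemma Ple_anti u v : Ple u v -> Ple v u -> u = v.
Proof. by rewrite /Ple => uv vu; rewrite -uv setUC vu. Qed.

Lemma b_setU A B : b (A `|` B) = b [set b A; b B].
Proof.
have -> : A `|` B = \bigcup_(C in [set A; B]) C by rewrite bigcup_setU !bigcup_set1.
by rewrite (P_alg_mult Pb) image_setU !image_set1.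
Qed.

Lemma Ple_b A x : A x -> Ple x (b A).
Proof.
move=> Ax; rewrite /Ple -{1}(P_alg_unit Pb x) -b_setU.
by congr b; apply/seteqP; split=> y; [case=> // -> | right].
Qed.

Lemma b_Ple A v : (forall x, A x -> Ple x v) -> Ple (b A) v.
Proof.
move=> Av; rewrite /Ple -{1}(P_alg_unit Pb v) -b_setU.
(* Since [b] sends each [[set x; v]] to [v], the images under [b] collapse to [[set v]]. The extra
   member [[set v]] covers the case of empty [A]. *)
have -> : A `|` [set v] = \bigcup_(B in [set [set x; v] | x in A] `|` [set [set v]]) B.
  apply/seteqP; split=> y.
  - case=> [Ay|->]; last by exists [set v] => //; right.
    by exists [set y; v]; [left; exists y | left].
  - case=> B [[x Ax <-]|->]; last by right.
    by case=> ->; [left | right].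
rewrite P_alg_mult // -[RHS](P_alg_unit Pb); congr b.
apply/seteqP; split=> y.
- by case=> B [[x /Av Ax <-]|->] <- //; exact: P_alg_unit.
- by move=> ->; exists [set v]; [right | exact: P_alg_unit].
Qed.

(** The distributive law makes the right side the supremum of all [a phi] with [phi] in
    [delta Phi]. *)
Lemma delta_Ple Phi phi : delta Phi phi -> Ple (a phi) (a (fsmap b Phi)).
Proof. by move=> h; rewrite (delta_alg_law Xab); apply: Ple_b; exists phi. Qed.

(** * Scaling *)

Lemma Ple_scale_b (l : S) A x : A x -> Ple (alg_scale a l x) (alg_scale a l (b A)).
Proof.
by move=> Ax; rewrite /alg_scale -fsmap_fsingle; apply/delta_Ple/delta_fsingle.
Qed.

Lemma Ple_scale (l : S) u v : Ple u v -> Ple (alg_scale a l u) (alg_scale a l v).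
Proof. by rewrite /Ple => uv; rewrite -uv; apply: Ple_scale_b; left. Qed.

Lemma alg_scaleA (l m : S) x : alg_scale a l (alg_scale a m x) = alg_scale a (l * m) x.
Proof. by rewrite /alg_scale -fsmap_fsingle -(S_alg_mult Sa) fsmult_fsingle. Qed.

Lemma alg_scale1 x : alg_scale a 1 x = x.
Proof. exact: S_alg_unit Sa x. Qed.

Lemma alg_scale_b (l m : S) (A : set X) : l * m = 1 -> m * l = 1 ->
  alg_scale a l (b A) = b (alg_scale a l @` A).
Proof.
move=> lm ml; apply: Ple_anti; last first.
  by apply: b_Ple => _ [x Ax <-]; exact: Ple_scale_b.
(* Writing the right side as [l] times its [m]-multiple cancels [l]; next, each [x] is written as
   [m] times [l] times [x], which cancels [m]. *)
rewrite -[X in Ple _ X]alg_scale1 -lm -alg_scaleA; apply: Ple_scale.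
apply: b_Ple => x Ax; rewrite -[x]alg_scale1 -ml -alg_scaleA; apply: Ple_scale.
by apply: Ple_b; exists x.
Qed.

(** * Addition *)

Lemma alg_addC x y : alg_add a x y = alg_add a y x.
Proof. by rewrite /alg_add fpairC. Qed.

(** Replacing each pair [(B, y)] in [theta] by [(C, g y)] gives a coupling whose first marginal is
    the Dirac function at [C], because [theta] has mass 1. The law then bounds the combination by
    [b C]. *)
Lemma Ple_convex (theta : fsupp S (ni X)) (B C : set X) (g : X -> X) :
  (forall p, theta p != 0 -> ni_set p = B) -> fsum setT theta = 1 ->
  (forall y, B y -> C (g y)) ->
  Ple (a (fsmap (g \o @ni_elt X) theta)) (b C).
Proof.
move=> thetaB theta1 gC.
(* The default value [p] is never taken on the support of [theta], by [hE]. *)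
pose h (p : ni X) : ni X :=
  if pselect (C (g (ni_elt p))) is left Cp
  then exist (fun q => q.1 q.2) (C, g (ni_elt p)) Cp else p.
have hE p : theta p != 0 -> sval (h p) = (C, g (ni_elt p)).
  move=> /thetaB; case: p => -[A y] /= Ay; rewrite /ni_set /= => AB.
  by rewrite /h /ni_elt /=; case: pselect => // nC; case: nC; apply: gC; rewrite -AB.
have := @delta_Ple (fsingle C 1) (fsmap (g \o @ni_elt X) theta).
rewrite fsmap_fsingle (S_alg_unit Sa); apply.
apply/deltaP; exists (fsmap h theta); rewrite fsmap_comp.
  rewrite -theta1 -fsmap_cst; apply: eq_fsmap => p /hE.
  by rewrite /ni_set /= => ->.
by apply: eq_fsmap => p /hE; rewrite /ni_elt /= => ->.
Qed.

Lemma alg_addr_b x B : positive_semiring S ->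
  alg_add a x (b B) = b (alg_add a x @` B).
Proof.
move=> pos; have [<-|xB] := pselect ([set x] = B).
  (* Here [fpair] would take the value [1 + 1] at a single set, so the two parts of a coupling could
     not be told apart; the unit law gives [x + x] on both sides. *)
  by rewrite image_set1 !P_alg_unit.
have addE : alg_add a x (b B) = a (fsmap b (fpair S [set x] B)).
  by rewrite fsmap_fpair P_alg_unit.
apply: Ple_anti.
  rewrite addE (delta_alg_law Xab); apply: b_Ple => _ [phi + <-].
  move=> /(delta_fpair_set1 pos xB)[theta [thetaB theta1] ->].
  rewrite (S_alg_mult Sa) fsmap_comp.
  exact: (@Ple_convex theta B _ (alg_add a x)).
apply: b_Ple => _ [y By <-]; rewrite addE.
exact/delta_Ple/delta_fpair.
Qed.

Lemma alg_add_b A B : positive_semiring S ->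
  alg_add a (b A) (b B) = b [set alg_add a p.1 p.2 | p in A `*` B].
Proof.
move=> pos; rewrite alg_addr_b //.
(* Distributing over [A] for each fixed [y] leaves a family of sets indexed by [B], which the
   multiplication law merges into one union. *)
have -> : alg_add a (b A) @` B = b @` [set (alg_add a ^~ y) @` A | y in B].
  rewrite image_comp; apply: eq_imagel => y _ /=.
  rewrite alg_addC alg_addr_b //; congr b.
  by apply: eq_imagel => z _; rewrite alg_addC.
rewrite -(P_alg_mult Pb); congr b; apply/seteqP; split=> z.
- by case=> _ [y By <-] [x Ax <-]; exists (x, y).
- by case=> [[x y] [/= Ax By] <-]; exists (alg_add a ^~ y @` A); [exists y | exists x].
Qed.

End DeltaAlgebra.

Theorem theorem5p9 (S : pzSemiRingType)
    (S_pos : positive_semiring S) (S_semifield : semifield S)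
    (X : Type) (a : fsupp S X -> X) (b : set X -> X)
    (Xab : delta_algebra a b) :
  (forall (A : set X) (l : S), l != 0 ->
     alg_scale a l (bigsqcup b A (fun x => x)) =
     bigsqcup b A (fun x => alg_scale a l x)) /\
  (forall A B : set X,
     alg_add a (bigsqcup b A (fun x => x)) (bigsqcup b B (fun y => y)) =
     bigsqcup b (A `*` B) (fun p => alg_add a p.1 p.2)).
Proof.
split=> [A l /S_semifield[m [lm ml]]|A B]; rewrite /bigsqcup !image_id.
- exact: (alg_scale_b Xab A lm ml).
- exact: (alg_add_b Xab).
Qed.
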